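(* For every $b\in[0,1]$ there is a monotone $(b,\beta(b))$-balanced contention resolution scheme for the bipartite matching polytope; that is, for every finite bipartite graph $G=(V,E)$ there is a monotone $(b,\beta(b))$-balanced contention resolution scheme for $P_{\mathcal{M}(G)}$.
   Context: Graphs may have parallel edges (no loops). For a graph $G=(V,E)$, $\mathcal{M}(G)\subseteq 2^E$ is the family of matchings and $P_{\mathcal{M}(G)}=\mathrm{conv}\{\chi^M: M\in\mathcal{M}(G)\}$ is the matching polytope; for bipartite $G$ it equals $\{x\in\mathbb{R}^E_{\ge0}: x(\delta(v))\le1\ \forall v\in V\}$. For $x\in[0,1]^E$, $R(x)$ denotes a random subset of $E$ containing each $e$ independently with probability $x_e$. For a down-closed family $\mathcal{F}\subseteq 2^E$ and a polytope $P\subseteq[0,1]^E$ with $P\cap\{0,1\}^E=P_{\mathcal{F}}\cap\{0,1\}^E$ (here $P=P_{\mathcal F}$), and $b,c\in[0,1]$, a $(b,c)$-balanced contention resolution (CR) scheme $\pi$ for $P$ is a procedure that, for every $x\in bP$ and $A\subseteq\mathrm{supp}(x)$, returns a (possibly random) set $\pi_x(A)\subseteq A$ with $\pi_x(A)\in\mathcal{F}$, such that $\Pr[e\in\pi_x(R(x))]\ge c\,x_e$ for all $e\in\mathrm{supp}(x)$. It is monotone if for all $x\in bP$, $\Pr[e\in\pi_x(A)]\ge\Pr[e\in\pi_x(B)]$ whenever $e\in A\subseteq B\subseteq\mathrm{supp}(x)$. Define $\beta(b)=\mathbb{E}\big[\frac{1}{1+\max\{X_1,X_2\}}\big]$, where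 $X_1,X_2$ are independent Poisson random variables with parameter $b$. *)

(* Defs.v *)
From HB Require Import structures.
From mathcomp Require Import all_boot all_order all_algebra.
From mathcomp Require Import all_classical all_reals all_analysis.

Set Implicit Arguments.
Unset Strict Implicit.
Unset Printing Implicit Defensive.
Import Order.TTheory GRing.Theory Num.Theory.

Local Open Scope classical_set_scope.
Local Open Scope ring_scope.

Section Multigraphs.

(* Edges are a type of their own, so parallel edges are allowed; each edge has
   two distinct ends, so loops are not. *)
Record multigraph (V E : finType) := Multigraph {
  ends : E -> {set V};
  card_ends : forall e, #|ends e| = 2
}.

Variables (V E : finType) (G : multigraph V E).

Definition bipartite : Prop :=
  exists A : {set V}, forall e, #|ends G e :&: A| = 1%N.

Definition is_matching (M : {set E}) : bool :=
  [forall e in M, forall f in M, (e != f) ==> [disjoint ends G e & ends G f]].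

Definition matchings : {set {set E}} := [set M | is_matching M]%SET.

End Multigraphs.

(* The space R^E; [R^o] is [R] seen as a left module over itself. *)
Notation vec R E := {ffun E -> R^o}.

Section Polytopes.
Variables (R : realType) (E : finType).

Definition chi (M : {set E}) : vec R E := [ffun e => (e \in M)%:R].

Definition convex_hull (S : set (vec R E)) : set (vec R E) :=
  smallest (@convex_set R (vec R E)) S.

Definition family_polytope (F : {set {set E}}) : set (vec R E) :=
  convex_hull (chi @` [set` F]).

Definition dilate (b : R) (P : set (vec R E)) : set (vec R E) :=
  [set b *: y | y in P].

Definition supp (x : vec R E) : {set E} := [set e | x e != 0]%SET.

End Polytopes.

Definition matching_polytope (R : realType) (V E : finType)
  (G : multigraph V E) : set (vec R E) := family_polytope (matchings G).

Arguments matching_polytope R {V E} G.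

(* The law of a random element of a finite type. *)
Record fdist (R : realType) (T : finType) := Fdist {
  pmf :> T -> R;
  pmf_ge0 : forall t, 0 <= pmf t;
  pmf_sum1 : \sum_t pmf t = 1
}.

Definition Prob (R : realType) (T : finType) (d : fdist R T) (A : pred T) : R :=
  \sum_(t | A t) d t.

Section ContentionResolution.
Variables (R : realType) (E : finType).
Implicit Types (F : {set {set E}}) (P : set (vec R E)) (b c : R) (x : vec R E).

(* Pr[R(x) = A]. *)
Definition Rx_pmf x (A : {set E}) : R :=
  (\prod_(e in A) x e) * \prod_(e in ~: A) (1 - x e).

(* [pi x A] is the law of the random set pi_x(A).  It is total; only the
   arguments with x in bP and A contained in supp(x) are ever constrained or
   used (Rx_pmf x A = 0 when A is not contained in supp(x)). *)
Definition scheme : Type := vec R E -> {set E} -> fdist R {set E}.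

(* Pr[e \in pi_x(R(x))], the randomness of pi being independent of R(x). *)
Definition selection_prob (pi : scheme) x (e : E) : R :=
  \sum_(A : {set E}) Rx_pmf x A * Prob (pi x A) (fun S => e \in S).

Definition is_CR_scheme F P b (pi : scheme) : Prop :=
  forall x (A S : {set E}), dilate b P x -> A \subset supp x ->
    pi x A S != 0 -> S \subset A /\ S \in F.

Definition balanced_scheme P b c (pi : scheme) : Prop :=
  forall x e, dilate b P x -> e \in supp x -> c * x e <= selection_prob pi x e.

Definition balanced_CR_scheme F P b c (pi : scheme) : Prop :=
  is_CR_scheme F P b pi /\ balanced_scheme P b c pi.

Definition monotone_scheme P b (pi : scheme) : Prop :=
  forall x e (A B : {set E}), dilate b P x ->
    e \in A -> A \subset B -> B \subset supp x ->
    Prob (pi x B) (fun S => e \in S) <= Prob (pi x A) (fun S => e \in S).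

End ContentionResolution.

Section ProductProbability.
Local Open Scope ereal_scope.
Context d1 d2 (T1 : measurableType d1) (T2 : measurableType d2) (R : realType).
Variables (P : probability T1 R) (Q : probability T2 R).

Definition product_prob : set (T1 * T2) -> \bar R := P \x Q.

HB.instance Definition _ := Measure.on product_prob.

Let product_prob_setT : product_prob setT = 1.
Proof.
rewrite /product_prob -setXTT product_measure1E//.
by rewrite -[RHS]mule1; congr (_ * _); exact: probability_setT.
Qed.

HB.instance Definition _ :=
  Measure_isProbability.Build _ _ _ product_prob product_prob_setT.

End ProductProbability.

(* The expectation is taken under the joint law of two independent Poisson
   variables X1, X2 of parameter [b], which are the two projections.  The
   argument [0%N] of [poisson_prob] is a dummy, and [poisson_prob 0 _] is the
   Dirac mass at 0. *)
Definition beta (R : realType) (b : R) : R :=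
  fine 'E_(product_prob (poisson_prob b 0%N) (poisson_prob b 0%N))
    [fun X => (1 + maxn X.1 X.2)%:R^-1].

(* Main.v *)
Require Import Defs.
From HB Require Import structures.
From mathcomp Require Import all_boot all_order all_algebra.
From mathcomp Require Import all_classical all_reals all_analysis.
From mathcomp Require Import measurable_realfun ring lra zify.

(* Each e in R(x) is kept with probability (1 - exp(-x_e)) / x_e and then given
   a Poisson(x_e) multiplicity conditioned on being positive, so that all edges
   carry independent multiplicities Q_e ~ Poisson(x_e).  The vector
   y_e = E[Q_e / max (Q(delta u), Q(delta v))], e = uv, has degrees at most 1,
   and since the bipartite matching polytope is integral it is the vector of
   marginals of a random matching.  Monotonicity holds because Q_e / max only
   decreases when further edges are present.
   For balancedness, E[Q f(Q)] = x E[f(Q + 1)] for Q ~ Poisson(x) gives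
   E[y_e] = x_e E[1 / (1 + max (Q(delta u), Q(delta v)))], where the two loads
   are Poisson of parameter at most b but share the edges parallel to e.  As
   1 / (1 + max) is supermodular and decreasing, the expectation can only drop
   when the loads are decoupled and their parameters raised to b.
   All series are truncated at a level N, which keeps every sum finite and loses
   a factor tending to 1. *)

Set Implicit Arguments.
Unset Strict Implicit.
Unset Printing Implicit Defensive.
Import Order.TTheory GRing.Theory Num.Theory.
Import numFieldNormedType.Exports.

Local Open Scope ring_scope.

(** * Poisson weights and their truncated convolution *)

HB.lock Definition pois (R : realType) (x : R) (k : nat) : R :=
  expR (- x) * (x ^+ k / k`!%:R).
Canonical pois_unlockable := Unlockable pois.unlock.
Arguments pois {R} x k.

Section TruncatedPoisson.
Variable R : realType.
Implicit Types (x y : R) (M N k n : nat).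

Definition pois_mass M x : R := \sum_(k < M) pois x k.

Lemma pois_ge0 x k : 0 <= x -> 0 <= pois x k.
Proof. by move=> x0; rewrite unlock mulr_ge0 ?expR_ge0// divr_ge0// exprn_ge0. Qed.

Lemma pois0 k : pois (0 : R) k = (k == 0%N)%:R.
Proof.
rewrite unlock oppr0 expR0 mul1r expr0n; case: k => [|k] /=; last by rewrite mul0r.
by rewrite fact0 divr1.
Qed.

Lemma poisS x k : k.+1%:R * pois x k.+1 = x * pois x k.
Proof.
have k1 : (k.+1%:R : R) != 0 by rewrite pnatr_eq0.
have kf : (k`!%:R : R) != 0 by rewrite pnatr_eq0 -lt0n fact_gt0.
rewrite unlock factS natrM exprS.
by move: k1 kf; move: (k.+1%:R) (k`!%:R) => c d c0 d0; field; rewrite c0 d0.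
Qed.

Lemma poisD x y n :
  pois (x + y) n = \sum_(i < n.+1) pois x i * pois y (n - i).
Proof.
have nf k : (k`!%:R : R) != 0 by rewrite pnatr_eq0 -lt0n fact_gt0.
rewrite unlock opprD expRD addrC exprDn mulr_suml mulr_sumr.
apply: eq_bigr => i _.
have /(congr1 (fun m => m%:R : R)) := @bin_fact n i (ltn_ord i).
rewrite !natrM => nE; rewrite -nE -mulr_natr.
have C0 : ('C(n, i)%:R : R) != 0 by rewrite pnatr_eq0 -lt0n bin_gt0 -ltnS.
by field; rewrite !nf C0.
Qed.

Lemma pois_mass_ge0 M x : 0 <= x -> 0 <= pois_mass M x.
Proof. by move=> x0; apply: sumr_ge0 => k _; apply: pois_ge0. Qed.

Lemma cvg_pois_mass x : (pois_mass M x @[M --> \oo] --> (1 : R))%classic.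
Proof.
rewrite -[X in (_ --> X)%classic](mulVf (lt0r_neq0 (expR_gt0 x))) -expRN.
have -> : pois_mass ^~ x = (fun M => expR (- x) * series (exp_coeff x) M).
  apply/funext => M; rewrite /pois_mass /series /= big_mkord mulr_sumr.
  by apply: eq_bigr => k _; rewrite unlock /exp_coeff.
apply: cvgMr; exact: is_cvg_series_exp_coeff.
Qed.

Lemma pois_mass_le1 M x : 0 <= x -> pois_mass M x <= 1.
Proof.
move=> x0; have cvg1 := @cvg_pois_mass x.
rewrite -(cvg_lim _ cvg1)//; apply: nondecreasing_cvgn_le.
  apply/nondecreasing_seqP => n.
  by rewrite /pois_mass big_ord_recr/= lerDl pois_ge0.
by apply/cvg_ex; exists 1.
Qed.

Lemma le_sum_ord M N (F : nat -> R) : (M <= N)%N -> (forall k, 0 <= F k) ->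
  \sum_(k < M) F k <= \sum_(k < N) F k.
Proof.
move=> MN F0; rewrite (big_ord_widen_cond _ (fun=> true) F MN) /=.
rewrite [leRHS](bigID (fun i : 'I_N => (i < M)%N)) /=.
by rewrite lerDl; apply: sumr_ge0 => i _; exact: F0.
Qed.

Lemma sum_ord_eq0 N : \sum_(k < N.+1) ((k : nat) == 0%N)%:R = 1 :> R.
Proof. by rewrite big_ord_recl big1 ?addr0 => [//|k _]. Qed.

(** By [poisD] the left side is a sum over the triangle i + j < M, which lies inside the square on
    the right; all terms are nonnegative. *)
Lemma pois_conv_le M x y (h : nat -> R) : 0 <= x -> 0 <= y ->
    (forall n, 0 <= h n) ->
  \sum_(n < M) pois (x + y) n * h n
  <= \sum_(i < M) \sum_(j < M) pois x i * pois y j * h (i + j)%N.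
Proof.
move=> x0 y0 h0.
have F0 i j : 0 <= pois x i * pois y j * h (i + j)%N.
  by rewrite !mulr_ge0 ?pois_ge0.
have -> : \sum_(n < M) pois (x + y) n * h n =
    \sum_(n < M) \sum_(i < M | (i < n.+1)%N)
      pois x i * pois y (n - i) * h (i + (n - i))%N.
  apply: eq_bigr => n _; rewrite poisD mulr_suml.
  rewrite (big_ord_widen_cond M (fun=> true)
    (fun i => pois x i * pois y (n - i) * h n) (ltn_ord n)) /=.
  by apply: eq_bigr => i lein; rewrite subnKC.
rewrite (exchange_big_dep (fun=> true))//=; apply: ler_sum => i _.
rewrite -(big_mkord (fun n => (i < n.+1)%N)
  (fun n => pois x i * pois y (n - i) * h (i + (n - i))%N)).
rewrite (@big_cat_nat _ _ _ i) //=; last exact: ltnW.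
rewrite big_nat_cond big1 ?add0r; last first.
  by move=> n /andP[/andP[_ ni]]; rewrite ltnS leqNgt ni.
rewrite -[X in index_iota X](add0n i) big_addn big_mkord.
rewrite (eq_bigr (fun j : 'I_(M - i) => pois x i * pois y j * h (i + j)%N));
  last by move=> j _; rewrite addnK.
rewrite big_mkcond /=.
under eq_bigr => j do rewrite ltnS leq_addl.
exact: (@le_sum_ord _ _ (fun j => pois x i * pois y j * h (i + j)%N) (leq_subr _ _)).
Qed.

End TruncatedPoisson.

(** * Decreasing supermodular functions of two Poisson loads *)

Section SupermodularPoisson.
Variable R : realType.
Implicit Types (x y : R) (M N k n : nat) (phi : nat -> nat -> R).

(** The order on pairs is expressed through added increments, which is how the multiplicity of one
    more edge enters the loads. *)
Record anti_supermod phi : Prop := AntiSupermod {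
  as_ge0 : forall n m, 0 <= phi n m;
  as_anti : forall n m k l, phi (n + k)%N (m + l)%N <= phi n m;
  as_super : forall n m k l,
    phi (n + k)%N m + phi n (m + l)%N <= phi n m + phi (n + k)%N (m + l)%N
}.

Lemma anti_supermod_shift phi i j : anti_supermod phi ->
  anti_supermod (fun n m => phi (i + n)%N (j + m)%N).
Proof.
case=> p0 pa ps; split=> [n m|n m k l|n m k l]; first exact: p0.
  by rewrite !addnA; apply: pa.
by rewrite !addnA; apply: ps.
Qed.

Lemma anti_supermod_sum (I : Type) (s : seq I) (c : I -> R) (F : I -> nat -> nat -> R) :
  (forall i, 0 <= c i) -> (forall i, anti_supermod (F i)) ->
  anti_supermod (fun n m => \sum_(i <- s) c i * F i n m).
Proof.
move=> c0 Fa; split=> [n m|n m k l|n m k l].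
- by apply: sumr_ge0 => i _; rewrite mulr_ge0// as_ge0.
- by apply: ler_sum => i _; rewrite ler_wpM2l// as_anti.
- rewrite -!big_split /=; apply: ler_sum => i _.
  by rewrite -!mulrDr ler_wpM2l// as_super.
Qed.

(** If, say, n + k <= m + l, then n + k and n have the same maximum with m + l, so two of the four
    terms cancel and monotonicity remains. *)
Lemma anti_supermod_invmax :
  anti_supermod (fun n m => ((1 + maxn n m)%:R)^-1 : R).
Proof.
have anti a b : (a <= b)%N -> (1 + b)%:R^-1 <= (1 + a)%:R^-1 :> R.
  by move=> ab; rewrite lef_pV2 ?posrE ?ltr0n// ler_nat; lia.
split=> [n m|n m k l|n m k l].
- by rewrite invr_ge0.
- by apply: anti; lia.
- have [le|le] : (n + k <= m + l)%N \/ (m + l <= n + k)%N by lia.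
    have -> : maxn (n + k) (m + l) = maxn n (m + l) by lia.
    by rewrite lerD2r; apply: anti; lia.
  have -> : maxn (n + k) (m + l) = maxn (n + k) m by lia.
  by rewrite addrC lerD2r; apply: anti; lia.
Qed.

(* The truncated sum only loses mass, so that every bound below has the
   direction needed for a lower bound on the selection probability. *)
Definition pois2 M x y phi : R :=
  \sum_(n < M) \sum_(m < M) pois x n * pois y m * phi n m.

Lemma pois2E M x y phi :
  pois2 M x y phi = \sum_(n < M) pois x n * \sum_(m < M) pois y m * phi n m.
Proof.
by apply: eq_bigr => n _; rewrite mulr_sumr; apply: eq_bigr => m _; rewrite mulrA.
Qed.

Lemma pois2C M x y phi : pois2 M x y phi = pois2 M y x (fun n m => phi m n).
Proof.
rewrite /pois2 exchange_big; apply: eq_bigr => n _; apply: eq_bigr => m _.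
by rewrite [pois x _ * _]mulrC.
Qed.

Lemma pois2_ge0 M x y phi : 0 <= x -> 0 <= y -> (forall n m, 0 <= phi n m) ->
  0 <= pois2 M x y phi.
Proof.
move=> x0 y0 p0; apply: sumr_ge0 => n _; apply: sumr_ge0 => m _.
by rewrite !mulr_ge0// pois_ge0.
Qed.

Lemma le_pois2 M x y phi psi : 0 <= x -> 0 <= y ->
  (forall n m, phi n m <= psi n m) -> pois2 M x y phi <= pois2 M x y psi.
Proof.
move=> x0 y0 p0; apply: ler_sum => n _; apply: ler_sum => m _.
by rewrite ler_wpM2l// mulr_ge0// pois_ge0.
Qed.

Lemma pois2_sum M x y (I : Type) (s : seq I) (c : I -> R) F :
  pois2 M x y (fun n m => \sum_(i <- s) c i * F i n m) =
  \sum_(i <- s) c i * pois2 M x y (F i).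
Proof.
rewrite /pois2.
under eq_bigr do under eq_bigr do rewrite mulr_sumr.
under eq_bigr do rewrite exchange_big.
rewrite exchange_big; apply: eq_bigr => i _; rewrite mulr_sumr.
by apply: eq_bigr => n _; rewrite mulr_sumr; apply: eq_bigr => m _; rewrite mulrCA.
Qed.

Lemma pois2_le0 M x y phi : 0 <= x -> 0 <= y -> anti_supermod phi ->
  pois2 M x y phi <= phi 0%N 0%N.
Proof.
move=> x0 y0 pa; apply: (@le_trans _ _ (pois2 M x y (fun _ _ => phi 0 0)%N)).
  by apply: le_pois2 => // n m; have := as_anti pa 0 0 n m; rewrite !add0n.
rewrite pois2E -mulr_suml -mulr_suml mulrA.
by rewrite ler_piMl ?as_ge0// mulr_ile1 ?pois_mass_ge0 ?pois_mass_le1.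
Qed.

Lemma pois2_addl M z x y phi : 0 <= z -> 0 <= x -> 0 <= y -> (forall n m, 0 <= phi n m) ->
  pois2 M (z + x) y phi <=
  \sum_(k < M) pois z k * pois2 M x y (fun n m => phi (k + n)%N m).
Proof.
move=> z0 x0 y0 p0; rewrite pois2E.
pose h n := \sum_(m < M) pois y m * phi n m.
have h0 n : 0 <= h n by apply: sumr_ge0 => m _; rewrite mulr_ge0// pois_ge0.
apply: le_trans (pois_conv_le M z0 x0 h0) _.
apply: ler_sum => k _; rewrite pois2E mulr_sumr.
by apply: ler_sum => n _; rewrite mulrA.
Qed.

Lemma pois2_addr M z x y phi : 0 <= z -> 0 <= x -> 0 <= y -> (forall n m, 0 <= phi n m) ->
  pois2 M x (z + y) phi <=
  \sum_(k < M) pois z k * pois2 M x y (fun n m => phi n (k + m)%N).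
Proof.
move=> z0 x0 y0 p0; rewrite pois2C.
apply: le_trans (pois2_addl _ z0 y0 x0 (fun n m => p0 m n)) _.
by apply: ler_sum => k _; rewrite pois2C.
Qed.

(* Symmetrising the supermodular inequality over the two independent shifts. *)
Lemma pois_decouple M z phi : 0 <= z -> anti_supermod phi -> forall n m,
  \sum_(k < M) \sum_(l < M) pois z k * pois z l * phi (k + n)%N (l + m)%N <=
  \sum_(k < M) pois z k * phi (k + n)%N (k + m)%N.
Proof.
move=> z0 pa n m.
pose S := \sum_(k < M) \sum_(l < M) pois z k * pois z l * phi (k + n)%N (l + m)%N.
pose T := \sum_(k < M) pois z k * phi (k + n)%N (k + m)%N.
have T0 : 0 <= T by apply: sumr_ge0 => k _; rewrite mulr_ge0 ?pois_ge0 ?as_ge0.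
have TM : pois_mass M z * T <= T by rewrite ler_piMl// pois_mass_le1.
have TE : pois_mass M z * T =
    \sum_(k < M) \sum_(l < M) pois z k * pois z l * phi (k + n)%N (k + m)%N.
  rewrite mulrC /T mulr_suml; apply: eq_bigr => k _.
  by rewrite mulr_sumr; apply: eq_bigr => l _; rewrite mulrAC.
have TE' : pois_mass M z * T =
    \sum_(k < M) \sum_(l < M) pois z k * pois z l * phi (l + n)%N (l + m)%N.
  rewrite TE exchange_big; apply: eq_bigr => k _; apply: eq_bigr => l _.
  by rewrite [pois z k * _]mulrC.
have SE : S = \sum_(k < M) \sum_(l < M) pois z k * pois z l * phi (l + n)%N (k + m)%N.
  rewrite /S exchange_big; apply: eq_bigr => k _; apply: eq_bigr => l _.
  by rewrite [pois z k * _]mulrC.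
have ST : S + S <= pois_mass M z * T + pois_mass M z * T.
  rewrite {1}/S SE {1}TE TE' -!big_split /=; apply: ler_sum => k _.
  rewrite -!big_split /=; apply: ler_sum => l _; rewrite -!mulrDr.
  apply: ler_wpM2l; first by rewrite mulr_ge0 ?pois_ge0.
  have shift i j r : (i <= j)%N -> (i + r + (j - i) = j + r)%N by lia.
  (* In either order of [k] and [l], supermodularity is used on the rectangle with opposite corners
     (k + n, k + m) and (l + n, l + m). *)
  have [kl|/ltnW lk] := leqP k l.
    by have := as_super pa (k + n) (k + m) (l - k) (l - k); rewrite !shift// addrC.
  have := as_super pa (l + n) (l + m) (k - l) (k - l); rewrite !shift//.
  by rewrite [X in _ -> _ <= X]addrC.
rewrite -/S -/T; lra.
Qed.

(** An edge of parameter [z] enters the first load if [a] holds and the second if [c] holds. If both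
    hold, [pois_decouple] trades its common multiplicity for two independent ones. The factor
    [pois_mass M z] gives equality when neither holds and is discarded as at most 1 otherwise, so
    that all four cases fit one inequality. *)
Lemma pois2_merge M z x y phi (a c : bool) : 0 <= z -> 0 <= x -> 0 <= y ->
    anti_supermod phi ->
  pois_mass M z * pois2 M (a%:R * z + x) (c%:R * z + y) phi <=
  \sum_(k < M) pois z k * pois2 M x y (fun n m => phi (a * k + n)%N (c * k + m)%N).
Proof.
move=> z0 x0 y0 pa; have p0 := as_ge0 pa.
have mass_le u v : 0 <= u -> 0 <= v ->
    pois_mass M z * pois2 M u v phi <= pois2 M u v phi.
  by move=> u0 v0; rewrite ler_piMl ?pois2_ge0 ?pois_mass_le1.
case: a c => [] [] /=; rewrite ?(mul1r, mul0r, add0r, mul0n).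
- apply: le_trans (mass_le _ _ _ _) _; rewrite ?addr_ge0//.
  apply: le_trans (pois2_addl _ z0 x0 _ p0) _; first exact: addr_ge0.
  apply: (@le_trans _ _ (\sum_(k < M) pois z k * \sum_(l < M) pois z l *
     pois2 M x y (fun n m => phi (k + n)%N (l + m)%N))).
    apply: ler_sum => k _; apply: ler_wpM2l; first exact: pois_ge0.
    exact: pois2_addr.
  under [X in _ <= X]eq_bigr do rewrite mul1n.
  rewrite -(pois2_sum M x y _ (fun k : 'I_M => pois z k)
     (fun (k : 'I_M) n m => phi (k + n)%N (k + m)%N)).
  under eq_bigr do rewrite -(pois2_sum M x y _ (fun l : 'I_M => pois z l)
     (fun (l : 'I_M) n m => phi (_ + n)%N (l + m)%N)).
  rewrite -(pois2_sum M x y _ (fun k : 'I_M => pois z k)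
     (fun (k : 'I_M) n m => \sum_(l < M) pois z l * phi (k + n)%N (l + m)%N)).
  apply: le_pois2 => // n m; apply: le_trans (pois_decouple M z0 pa n m).
  apply: ler_sum => k _; rewrite mulr_sumr; apply: ler_sum => l _.
  by rewrite mulrA.
- apply: le_trans (mass_le _ _ _ _) _; rewrite ?addr_ge0//.
  apply: le_trans (pois2_addl _ z0 x0 y0 p0) _.
  by apply: ler_sum => k _; rewrite mul1n.
- apply: le_trans (mass_le _ _ _ _) _; rewrite ?addr_ge0//.
  apply: le_trans (pois2_addr _ z0 x0 y0 p0) _.
  by apply: ler_sum => k _; rewrite mul1n.
- by rewrite /pois_mass mulr_suml; apply: ler_sum => k _.
Qed.

(** Since b = (b - x) + x, raising a parameter to [b] adds an independent Poisson variable to a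
    load, which cannot increase [phi]. *)
Lemma pois2_anti M x y b phi : 0 <= x <= b -> 0 <= y <= b -> anti_supermod phi ->
  pois2 M b b phi <= pois2 M x y phi.
Proof.
move=> /andP[x0 xb] /andP[y0 yb] pa; have p0 := as_ge0 pa.
have b0 : 0 <= b by apply: le_trans xb.
have contract z u v (psi : nat -> nat -> nat -> R) : 0 <= z -> 0 <= u -> 0 <= v ->
    (forall k n m, psi k n m <= phi n m) ->
    \sum_(k < M) pois z k * pois2 M u v (psi k) <= pois2 M u v phi.
  move=> z0 u0 v0 le; apply: (@le_trans _ _ (pois_mass M z * pois2 M u v phi)).
    rewrite mulr_suml; apply: ler_sum => k _; apply: ler_wpM2l; first exact: pois_ge0.
    exact: le_pois2.
  by rewrite ler_piMl ?pois2_ge0 ?pois_mass_le1.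
apply: (@le_trans _ _ (pois2 M x b phi)).
  have bx : 0 <= b - x by rewrite subr_ge0.
  rewrite -{1}(subrK x b); apply: le_trans (pois2_addl _ bx x0 b0 p0) _.
  apply: (contract _ _ _ (fun k n m => phi (k + n)%N m)) => // k n m.
  by have := as_anti pa n m k 0; rewrite addn0 addnC.
have by0 : 0 <= b - y by rewrite subr_ge0.
rewrite -{1}(subrK y b); apply: le_trans (pois2_addr _ by0 x0 y0 p0) _.
apply: (contract _ _ _ (fun k n m => phi n (k + m)%N)) => // k n m.
by have := as_anti pa n m 0 k; rewrite addn0 [X in phi _ X]addnC.
Qed.

End SupermodularPoisson.

(** * Finite sums over independent multiplicities *)

Section ProductSums.
Variables (R : realType) (E : finType).
Implicit Types (W : E -> nat -> R) (h : (E -> nat) -> R) (N : nat).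

Definition upd (q : E -> nat) e k : E -> nat := fun f => if f == e then k else q f.

(** Expectation of [h] under independent multiplicities with weights [W f] cut off above [N]; the
    total mass may differ from 1. *)
Definition prodsum N W h : R :=
  \sum_(q : {ffun E -> 'I_N.+1}) (\prod_f W f (q f)) * h (fun f => q f).

Lemma le_prodsum N W h1 h2 : (forall f k, 0 <= W f k) -> (forall q, h1 q <= h2 q) ->
  prodsum N W h1 <= prodsum N W h2.
Proof.
move=> W0 h12; apply: ler_sum => q _; rewrite ler_wpM2l//.
by apply: prodr_ge0 => f _; apply: W0.
Qed.

Lemma prodsum_ge0 N W h : (forall f k, 0 <= W f k) -> (forall q, 0 <= h q) ->
  0 <= prodsum N W h.
Proof.
move=> W0 h0; apply: sumr_ge0 => q _; rewrite mulr_ge0//.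
by apply: prodr_ge0 => f _; apply: W0.
Qed.

Lemma prodsumZ N W h c : prodsum N W (fun q => c * h q) = c * prodsum N W h.
Proof. by rewrite mulr_sumr; apply: eq_bigr => q _; rewrite mulrCA. Qed.

Lemma prodsum_cst N W c :
  prodsum N W (fun=> c) = (\prod_f \sum_(k < N.+1) W f k) * c.
Proof.
by rewrite (bigA_distr_bigA (fun f (k : 'I_N.+1) => W f k)) mulr_suml.
Qed.

Lemma prodsum_sum N W (I : Type) (s : seq I) (P : pred I) (H : I -> (E -> nat) -> R) :
  \sum_(i <- s | P i) prodsum N W (H i) =
  prodsum N W (fun q => \sum_(i <- s | P i) H i q).
Proof.
by rewrite /prodsum exchange_big; apply: eq_bigr => q _; rewrite mulr_sumr.
Qed.

Lemma le_prodsum_trunc M N W h : (M <= N)%N -> (forall f k, 0 <= W f k) ->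
  (forall q, 0 <= h q) -> prodsum M W h <= prodsum N W h.
Proof.
rewrite -ltnS => MN W0 h0; rewrite /prodsum.
have W0' (q : {ffun E -> 'I_N.+1}) : 0 <= \prod_f W f (q f).
  by apply: prodr_ge0 => f _; apply: W0.
pose w (q : {ffun E -> 'I_M.+1}) : {ffun E -> 'I_N.+1} := [ffun f => widen_ord MN (q f)].
rewrite [leRHS](bigID (fun q : {ffun E -> 'I_N.+1} => [forall f, q f < M.+1]%N)) /=.
rewrite (reindex_onto w (fun q => [ffun f => inord (q f)])) /=; last first.
  move=> q /forallP qM; apply/ffunP => f; rewrite !ffunE; apply: val_inj => /=.
  by rewrite inordK.
rewrite [X in _ <= X + _](eq_bigl xpredT); last first.
  move=> q; apply/andP; split.
    by apply/forallP => f; rewrite ffunE /= ltn_ord.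
  by apply/eqP/ffunP => f; rewrite !ffunE /= inord_val.
under [X in _ <= X + _]eq_bigr => q _.
  under eq_bigr => f _ do rewrite ffunE /=.
  rewrite (_ : (fun f => _) = (fun f => q f : nat)); last first.
    by apply/funext => f; rewrite ffunE.
  over.
by rewrite lerDl; apply: sumr_ge0 => q _; rewrite mulr_ge0.
Qed.

(** [W'] pins coordinate [e] at 0, so the vectors that count on the right index the fibres of
    resetting that coordinate to 0, and the sum along a fibre moves inside. *)
Lemma prodsum_split N W W' e h :
    (forall k, W' e k = (k == 0%N)%:R) -> (forall f, f != e -> W' f =1 W f) ->
  prodsum N W h = prodsum N W' (fun q => \sum_(k < N.+1) W e k * h (upd q e k)).
Proof.
move=> W'e W'f; rewrite /prodsum.
pose fupd (q : {ffun E -> 'I_N.+1}) (k : 'I_N.+1) : {ffun E -> 'I_N.+1} :=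
  [ffun f => if f == e then k else q f].
rewrite (partition_big (fun q => fupd q ord0) xpredT) //=; apply: eq_bigr => q _.
(* If [q e] is nonzero, the fibre over [q] is empty and [W'] gives [q] weight 0, so both sides
   vanish. *)
have [qe0|qe0] := eqVneq (q e) ord0; last first.
  rewrite (bigD1 e) //= W'e (_ : (q e == 0%N :> nat) = false) ?mul0r; last first.
    by apply/negbTE.
  rewrite big1 // => r /eqP rq.
  by move/eqP: qe0; case; rewrite -rq ffunE eqxx.
rewrite (reindex_onto (fupd q) (fun r => r e)) /=; last first.
  by move=> r /eqP <-; apply/ffunP => f; rewrite !ffunE; case: eqP => // ->.
rewrite (eq_bigl xpredT); last first.
  move=> k; rewrite !ffunE !eqxx andbT; apply/eqP/ffunP => f.
  by rewrite !ffunE; case: eqP => // ->.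
rewrite mulr_sumr; apply: eq_bigr => k _.
rewrite (bigD1 e) //= [X in _ = X * _](bigD1 e) //= W'e qe0 eqxx mul1r !ffunE eqxx.
rewrite mulrA [in RHS](mulrC _ (W e k)); congr (_ * _ * h _).
  by apply: eq_bigr => f fe; rewrite !ffunE (negbTE fe) W'f.
by apply/funext => f; rewrite ffunE /upd; case: eqP.
Qed.

(** Summing out coordinate [e] first leaves an average, with weights of mass at most 1, of values
    bounded by the one at 0. *)
Lemma prodsum_drop N W W' e h :
    (forall k, W' e k = (k == 0%N)%:R) -> (forall f, f != e -> W' f =1 W f) ->
    (forall f k, 0 <= W f k) -> \sum_(k < N.+1) W e k <= 1 ->
    (forall q, 0 <= h q) -> (forall q k, h (upd q e k) <= h (upd q e 0)) ->
  prodsum N W h <= prodsum N W' h.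
Proof.
move=> W'e W'f W0 We1 h0 hanti.
rewrite [leLHS](prodsum_split _ _ W'e)// [leRHS](prodsum_split _ _ W'e)//.
apply: le_prodsum => [f k|q].
  have [->|/W'f->//] := eqVneq f e.
  by rewrite W'e.
rewrite [leRHS](bigD1 ord0)//= W'e mul1r [X in _ + X]big1 ?addr0; last first.
  move=> k k0; rewrite W'e (_ : (k == 0%N :> nat) = false) ?mul0r//.
  by apply/negbTE.
apply: (@le_trans _ _ (\sum_(k < N.+1) W e k * h (upd q e 0))).
  by apply: ler_sum => k _; rewrite ler_wpM2l.
by rewrite -mulr_suml ler_piMl.
Qed.

End ProductSums.

(** * Lower bounds for Poisson multiplicities on edges *)

Section PoissonProducts.
Variables (R : realType) (E : finType) (x : E -> R).
Hypothesis x_ge0 : forall f, 0 <= x f.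
Implicit Types (s : seq E) (a c : E -> bool).

(** Coordinates outside [s] get unit mass at 0, so that an induction on [s] brings in Poisson edges
    one by one over a fixed index type. *)
Definition pois_on s f k : R := if f \in s then pois (x f) k else (k == 0%N)%:R.

Lemma pois_on_ge0 s f k : 0 <= pois_on s f k.
Proof. by rewrite /pois_on; case: ifP => // _; apply: pois_ge0. Qed.

Lemma prodsum_pois_cons N e s h : e \notin s ->
  prodsum N (pois_on (e :: s)) h =
  prodsum N (pois_on s) (fun q => \sum_(k < N.+1) pois (x e) k * h (upd q e k)).
Proof.
move=> es; rewrite (@prodsum_split _ _ _ _ (pois_on s) e).
- apply: eq_bigr => q _; congr (_ * _); apply: eq_bigr => k _.
  by rewrite /pois_on inE eqxx.
- by move=> k; rewrite /pois_on (negbTE es).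
- by move=> f fe k; rewrite /pois_on inE (negbTE fe).
Qed.

Lemma sum_upd_notin a e s q k : e \notin s ->
  (\sum_(f <- s) a f * upd q e k f = \sum_(f <- s) a f * q f)%N.
Proof.
move=> es; apply: eq_big_seq => f fs; rewrite /upd; case: eqP => // fe.
by rewrite -fe fs in es.
Qed.

(** Induction on [s]: [pois2_merge] handles the head edge, whose multiplicity turns [phi] into a
    shifted function of the same class, hence the quantification over [phi]. Here [a] and [c] mark
    the edges counted in each load; an edge may count in both. *)
Lemma prodsum_pois_ge N M a c s phi : (M <= N.+1)%N -> uniq s -> anti_supermod phi ->
  (\prod_(f <- s) pois_mass M (x f)) *
    pois2 M (\sum_(f <- s) (a f)%:R * x f) (\sum_(f <- s) (c f)%:R * x f) phi <=
  prodsum N (pois_on s)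
    (fun q => phi (\sum_(f <- s) a f * q f)%N (\sum_(f <- s) c f * q f)%N).
Proof.
move=> MN; elim: s phi => [|e s IHs] phi /= => [_ pa|/andP[es us] pa].
  rewrite !big_nil mul1r.
  under eq_fun do rewrite !big_nil.
  rewrite prodsum_cst big1 ?mul1r; first exact: pois2_le0.
  by move=> f _; rewrite /pois_on sum_ord_eq0.
have ax0 (d : E -> bool) : 0 <= \sum_(f <- s) (d f)%:R * x f.
  by apply: sumr_ge0 => f _; rewrite mulr_ge0.
have P0 : 0 <= \prod_(f <- s) pois_mass M (x f).
  by apply: prodr_ge0 => f _; apply: pois_mass_ge0.
rewrite !big_cons mulrAC mulrC mulrCA mulrC -mulrA.
apply: le_trans (ler_wpM2l P0 _) _.
  by rewrite mulrC; apply: (pois2_merge _ (a e) (c e) (x_ge0 e) (ax0 a) (ax0 c) pa).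
rewrite prodsum_pois_cons// -(prodsum_sum N _ _ _ (fun (k : 'I_N.+1) q => _)).
rewrite mulr_sumr.
pose psi k n m := phi (a e * k + n)%N (c e * k + m)%N.
have psia k : anti_supermod (psi k) by apply: anti_supermod_shift.
pose F k := pois (x e) k * prodsum N (pois_on s)
  (fun q => psi k (\sum_(f <- s) a f * q f) (\sum_(f <- s) c f * q f))%N.
apply: (@le_trans _ _ (\sum_(k < M) F k)).
  apply: ler_sum => k _; rewrite mulrCA ler_wpM2l ?pois_ge0//.
  exact: (IHs (psi k) us (psia k)).
apply: le_trans (le_sum_ord MN _) _ => [k|].
  rewrite mulr_ge0 ?pois_ge0//; apply: prodsum_ge0 => [|q]; first exact: pois_on_ge0.
  exact: as_ge0.
apply: ler_sum => k _; rewrite /F -prodsumZ; apply: le_prodsum => [|q].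
  exact: pois_on_ge0.
by rewrite !big_cons !sum_upd_notin// /upd eqxx.
Qed.

(** For edge [e], [poisS] removes the numerator and shifts its multiplicity by one, which yields the
    1 in 1 / (1 + max). What remains of its multiplicity counts in both loads and is merged into
    them before the parameters are raised to [b]. *)
Lemma prodsum_pois_share N M b e a c : (M <= N)%N -> a e -> c e ->
    \sum_f (a f)%:R * x f <= b -> \sum_f (c f)%:R * x f <= b ->
  x e * ((\prod_f pois_mass M (x f)) *
    pois2 M b b (fun n m => (1 + maxn n m)%:R^-1)) <=
  prodsum N (fun f => pois (x f)) (fun q =>
    (q e)%:R / (maxn (\sum_f a f * q f) (\sum_f c f * q f))%:R).
Proof.
move=> MN ae ce ab cb.
pose s := rem e (enum E).
have us : uniq s by rewrite rem_uniq ?enum_uniq.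
have es : e \notin s by rewrite mem_rem_uniqF ?enum_uniq.
have ps : perm_eq (enum E) (e :: s) by rewrite perm_to_rem ?mem_enum.
have sumE (T : Type) (idx : T) (op : Monoid.com_law idx) (F : E -> T) :
    \big[op/idx]_f F f = op (F e) (\big[op/idx]_(f <- s) F f).
  by rewrite -big_enum (perm_big _ ps) big_cons.
have ax0 (d : E -> bool) : 0 <= \sum_(f <- s) (d f)%:R * x f.
  by apply: sumr_ge0 => f _; rewrite mulr_ge0.
pose g n m : R := (1 + maxn n m)%:R^-1.
have ga : anti_supermod g by apply: anti_supermod_invmax.
pose phi n m := \sum_(k < M) pois (x e) k * g (k + n)%N (k + m)%N.
have phia : anti_supermod phi.
  apply: anti_supermod_sum => k; first exact: pois_ge0.
  exact: anti_supermod_shift.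
have -> : prodsum N (fun f => pois (x f)) (fun q =>
    (q e)%:R / (maxn (\sum_f a f * q f) (\sum_f c f * q f))%:R) =
  prodsum N (pois_on (e :: s)) (fun q =>
    (q e)%:R / (maxn (\sum_f a f * q f) (\sum_f c f * q f))%:R).
  apply: eq_bigr => q _; congr (_ * _); apply: eq_bigr => f _.
  by rewrite /pois_on -(perm_mem ps) mem_enum.
rewrite prodsum_pois_cons//.
apply: (@le_trans _ _ (x e * prodsum N (pois_on s)
    (fun q => phi (\sum_(f <- s) a f * q f) (\sum_(f <- s) c f * q f))%N)).
  apply: ler_wpM2l => //; apply: le_trans (prodsum_pois_ge a c (leqW MN) us phia).
  rewrite sumE /= (mulrC (pois_mass M (x e))) -mulrA. apply: ler_wpM2l.
    by apply: prodr_ge0 => f _; apply: pois_mass_ge0.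
  rewrite (pois2_sum _ _ _ _ (fun k : 'I_M => pois (x e) k)
    (fun (k : 'I_M) n m => g (k + n)%N (k + m)%N)).
  have := pois2_merge M true true (x_ge0 e) (ax0 a) (ax0 c) ga.
  under [X in _ <= X -> _]eq_bigr do rewrite !mul1n.
  apply: le_trans; rewrite ler_wpM2l ?pois_mass_ge0//.
  apply: pois2_anti => //; apply/andP; split; rewrite ?addr_ge0 ?mulr_ge0//.
    by move: ab; rewrite sumE /= ae.
  by move: cb; rewrite sumE /= ce.
rewrite -prodsumZ; apply: le_prodsum => [|q]; first exact: pois_on_ge0.
have updE (d : E -> bool) k : d e ->
    (\sum_f d f * upd q e k f = k + \sum_(f <- s) d f * q f)%N.
  by move=> de; rewrite sumE /= sum_upd_notin// /upd eqxx de mul1n.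
(* The term at 0 vanishes with its numerator; the others are reindexed as k + 1 with k < [N], a
   range that contains k < [M]. *)
rewrite big_ord_recl [X in _ <= X + _](_ : _ = 0); last first.
  by rewrite {1}/upd eqxx mul0r mulr0.
rewrite add0r mulr_sumr.
pose F k := x e * (pois (x e) k *
  g (k + \sum_(f <- s) a f * q f)%N (k + \sum_(f <- s) c f * q f)%N).
apply: le_trans (@le_sum_ord _ _ _ F MN _) _ => [k|].
  by rewrite !mulr_ge0 ?pois_ge0// as_ge0.
apply: ler_sum => k _; rewrite !lift0 !updE// /upd eqxx.
rewrite [leRHS]mulrA [X in _ <= X * _]mulrC poisS -mulrA.
by rewrite /F /g add1n !addSn maxnSS.
Qed.

End PoissonProducts.

(** * Point masses and mixtures on a finite type *)

Section FiniteLaws.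
Variables (R : realType) (T : finType).

Definition fdirac (t0 : T) : fdist R T.
Proof.
exists (fun t => (t == t0)%:R) => [t|]; first by [].
by rewrite (bigD1 t0)//= eqxx big1 ?addr0 // => t /negbTE->.
Defined.

Lemma Prob_fdirac t0 (A : pred T) : Prob (fdirac t0) A = (A t0)%:R.
Proof.
rewrite /Prob big_mkcond (bigD1 t0)//= eqxx big1 ?addr0; first by case: (A t0).
by move=> t /negbTE->; rewrite if_same.
Qed.

Lemma fmix_ge0 (p : R) (d1 d2 : fdist R T) : 0 <= p <= 1 ->
  forall t, 0 <= p * d1 t + (1 - p) * d2 t.
Proof.
move=> /andP[p0 p1] t.
by apply: addr_ge0; apply: mulr_ge0; rewrite ?subr_ge0//; exact: Defs.pmf_ge0.
Qed.

Lemma fmix_sum1 (p : R) (d1 d2 : fdist R T) :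
  \sum_t (p * d1 t + (1 - p) * d2 t) = 1.
Proof. by rewrite big_split /= -!mulr_sumr !Defs.pmf_sum1; ring. Qed.

Definition fmix (p : R) (p01 : 0 <= p <= 1) (d1 d2 : fdist R T) : fdist R T :=
  Fdist (fmix_ge0 d1 d2 p01) (fmix_sum1 p d1 d2).

Lemma Prob_fmix p (p01 : 0 <= p <= 1) d1 d2 (A : pred T) :
  Prob (fmix p01 d1 d2) A = p * Prob d1 A + (1 - p) * Prob d2 A.
Proof. by rewrite /Prob big_split /= -!mulr_sumr. Qed.

Lemma Prob_eq0 (d : fdist R T) (A : pred T) t : Prob d A = 0 -> A t -> d t = 0.
Proof.
move=> PA At; apply/eqP; rewrite eq_le Defs.pmf_ge0 andbT -PA /Prob (bigD1 t)//= lerDl.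
by apply: sumr_ge0 => s _; apply: Defs.pmf_ge0.
Qed.

End FiniteLaws.

(** * The largest feasible step along a direction *)

Section RatioTest.
Variables (R : realFieldType) (I : finType) (a c : I -> R).

(** The step is the least [a i / - c i] over the indices with [c i < 0]. It is positive because such
    an [a i] cannot be 0, and the minimising index reaches 0. *)
Lemma ratio_test : (forall i, 0 <= a i) -> (forall i, a i = 0 -> c i = 0) ->
    (exists i, c i < 0) ->
  exists2 t, 0 < t & (forall i, 0 <= a i + t * c i) /\
    exists2 i, a i != 0 & a i + t * c i = 0.
Proof.
move=> a0 ac [i0 ci0].
case: (arg_minP (P := fun i => c i < 0) (fun i => a i / - c i) ci0) => i ci imin.
have ai : a i != 0 by apply: contraTneq ci => /ac ->; rewrite ltxx.
have tE : a i / - c i * c i = - a i.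
  by field; rewrite ?oppr_eq0 lt_eqF.
exists (a i / - c i).
  by rewrite divr_gt0 ?oppr_gt0// lt_neqAle eq_sym ai a0.
split; last by exists i => //; rewrite tE subrr.
move=> j; have [cj|cj] := ltP (c j) 0.
  have := imin j cj; rewrite ler_pdivlMr ?oppr_gt0//; lra.
by rewrite addr_ge0// mulr_ge0// divr_ge0// oppr_ge0 ltW.
Qed.

End RatioTest.

(** * Integrality of the bipartite matching polytope *)

Section BipartiteIntegrality.
Variables (R : realType) (V E : finType) (G : multigraph V E).
Implicit Types (y d : E -> R) (v : V) (e : E).

Definition degree y v : R := \sum_(e | v \in ends G e) y e.

Lemma card_ends2 e : #|ends G e| = 2%N.
Proof. exact: card_ends. Qed.

Lemma degreeD y d t v : degree (fun e => y e + t * d e) v = degree y v + t * degree d v.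
Proof. by rewrite /degree big_split /= mulr_sumr. Qed.

Lemma le_degree y v e : (forall f, 0 <= y f) -> v \in ends G e -> y e <= degree y v.
Proof.
by move=> y0 ve; rewrite /degree (bigD1 e)//= lerDl; apply: sumr_ge0.
Qed.

Lemma le_degree2 y v e f : (forall f, 0 <= y f) -> e != f ->
  v \in ends G e -> v \in ends G f -> y e + y f <= degree y v.
Proof.
move=> y0 ef ve vf; rewrite /degree (bigD1 e)//= (bigD1 f)//=; last by rewrite vf eq_sym.
by rewrite addrA lerDl; apply: sumr_ge0.
Qed.

Lemma end_of e : exists v, v \in ends G e.
Proof. by apply/card_gt0P; rewrite card_ends2. Qed.

(** Edge and vertex constraints share one vector, so that a single ratio test treats both and its
    nonzero entries can serve as induction measure. *)
Definition slack y (i : E + V) : R :=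
  match i with inl e => y e | inr v => 1 - degree y v end.

Lemma slack_shift y d t i : slack (fun e => y e + t * d e) i =
  slack y i + t * match i with inl e => d e | inr v => - degree d v end.
Proof. by case: i => //= v; rewrite degreeD; ring. Qed.

Definition fractional y : {set E} := [set e | 0 < y e < 1]%SET.

(** Double counting of incidences: at least 2 per vertex of [T], at most 2 per edge of [F]. If [F]
    is no larger than [T], every edge must attain its 2. *)
Lemma card_tight_le (F : {set E}) (T : {set V}) :
    (forall v, v \in T -> 2 <= #|[set e in F | v \in ends G e]|)%N ->
  (#|T| <= #|F|)%N /\ ((#|F| <= #|T|)%N -> forall e, e \in F -> ends G e \subset T).
Proof.
move=> T2.
have le2 : (#|T| * 2 <= \sum_(e in F) #|ends G e :&: T|)%N.
  rewrite -sum_nat_const.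
  apply: (@leq_trans (\sum_(v in T) #|[set e in F | v \in ends G e]|)).
    by apply: leq_sum => v /T2.
  under eq_bigr do rewrite -sum1dep_card.
  rewrite (exchange_big_dep (fun e => e \in F)) /=; last by move=> v e _ /andP[].
  apply: leq_sum => e eF; rewrite -sum1_card; apply: eq_leq; apply: eq_bigl => v.
  by rewrite !inE eF andbC.
have end2 e : (#|ends G e :&: T| <= 2)%N.
  by rewrite -(card_ends2 e) subset_leq_card// subsetIl.
have ub : (\sum_(e in F) #|ends G e :&: T| <= #|F| * 2)%N.
  by rewrite -sum_nat_const; apply: leq_sum.
split=> [|FT e eF]; first by rewrite -(leq_pmul2r (m := 2))//; apply: leq_trans ub.
apply/finset.setIidPl/eqP; rewrite eqEcard subsetIl card_ends2 leqNgt; apply/negP => lt2.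
have : (\sum_(e in F) #|ends G e :&: T| < #|F| * 2)%N.
  rewrite -sum_nat_const (bigD1 e)//= [ltnRHS](bigD1 e)//=.
  by rewrite -addSn leq_add// leq_sum.
rewrite ltnNge => /negP; apply; apply: leq_trans le2.
by rewrite leq_mul2r FT.
Qed.

(* When there are as many tight vertices as fractional edges, every fractional
   edge has both ends tight, and the +1/-1 colouring of the two sides is a
   linear relation between the tight degree constraints. *)
Lemma tight_not_row_free (F : {set E}) (T : {set V}) :
    bipartite G -> F != finset.set0 ->
    (forall v, v \in T -> 2 <= #|[set e in F | v \in ends G e]|)%N ->
  ~~ row_free (\matrix_(i < #|F|, j < #|T|)
      (enum_val j \in ends G (enum_val i))%:R : 'M[R]_(_, _)).
Proof.
move=> [S S1] F0 T2; have [TF FT] := card_tight_le T2.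
set A := \matrix_(i, j) _; apply/negP => Afree.
have rA : \rank A = #|F| by apply/eqP.
have leFT : (#|F| <= #|T|)%N by rewrite -rA rank_leq_col.
have cardFT : #|F| = #|T| by apply/eqP; rewrite eqn_leq leFT.
have /row_fullP[B BA] : row_full A by rewrite /row_full rA cardFT.
pose sg v : R := if v \in S then 1 else -1.
pose s : 'cV[R]_#|T| := \col_j sg (enum_val j).
have As : A *m s = 0.
  apply/colP => i; rewrite !mxE.
  under eq_bigr do rewrite !mxE.
  set e := enum_val i.
  have eF : e \in F by apply: enum_valP.
  rewrite -(big_enum_val (A := mem T) (fun v => (v \in ends G e)%:R * sg v)).
  have eT := FT leFT e eF.
  transitivity (\sum_(v in ends G e) sg v).
    rewrite big_mkcond [RHS]big_mkcond; apply: eq_bigr => v _.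
    case: (boolP (v \in ends G e)) => [/(fintype.subsetP eT) -> |_].
      by rewrite mul1r.
    by rewrite mul0r if_same.
  rewrite (bigID (fun v => v \in S)) /=.
  rewrite (eq_bigr (fun=> 1)); last by move=> v /andP[_ vS]; rewrite /sg vS.
  rewrite [X in _ + X](eq_bigr (fun=> -1)); last first.
    by move=> v /andP[_ /negbTE vS]; rewrite /sg vS.
  have c1 : #|[pred v | (v \in ends G e) && (v \in S)]| = 1%N.
    by rewrite -(S1 e); apply: eq_card => v; rewrite !inE.
  have c2 : #|[pred v | (v \in ends G e) && (v \notin S)]| = 1%N.
    have := cardsID S (ends G e); rewrite S1 card_ends2 => -[] <-.
    by apply: eq_card => v; rewrite !inE andbC.
  by rewrite !sumr_const c1 c2 subrr.
have s0 : s = 0 by rewrite -[s]mul1mx -BA -mulmxA As mulmx0.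
have T0 : (0 < #|T|)%N by rewrite -cardFT card_gt0.
have /eqP := congr1 (fun M : 'cV[R]_#|T| => M (Ordinal T0) 0) s0; rewrite !mxE /sg.
by case: ifP => _; rewrite ?oppr_eq0 oner_eq0.
Qed.

(** By [tight_not_row_free] the incidence matrix of fractional edges and the tight vertices they
    meet has a nonzero left kernel vector; extended by 0 to all edges, it is the direction. *)
Lemma fractional_direction y : bipartite G -> (forall e, 0 <= y e) ->
    (forall v, degree y v <= 1) -> fractional y != finset.set0 ->
  exists d, [/\ exists e, d e != 0, forall e, d e != 0 -> e \in fractional y
    & forall v, degree y v = 1 -> degree d v = 0].
Proof.
move=> Gb y0 y1 F0; set F := fractional y in F0 *.
pose T := [set v | (degree y v == 1) && [exists e in F, v \in ends G e]]%SET.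
have T2 v : v \in T -> (2 <= #|[set e in F | v \in ends G e]%SET|)%N.
  rewrite inE => /andP[/eqP yv /existsP[e /andP[eF ve]]].
  move: eF; rewrite inE => /andP[ye0 ye1].
  rewrite (cardD1 e) !inE ye0 ye1 ve /=.
  (* The rest of the degree is nonzero, so another edge [f] at [v] has positive value, and y e + y f
     <= 1 makes it fractional. *)
  have : degree y v - y e != 0 by rewrite yv subr_eq0 eq_sym lt_eqF.
  rewrite /degree (bigD1 e)//= addrAC subrr add0r => sum0.
  have [f /andP[vf fe] yf0] : exists2 f, (v \in ends G f) && (f != e) & y f != 0.
    apply/exists_inP; apply: contraR sum0; rewrite negb_exists_in => /forall_inP h.
    by apply/eqP/big1 => f /h; rewrite negbK => /eqP.
  rewrite (cardD1 f) !inE fe vf andbT.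
  have yf : 0 < y f by rewrite lt_neqAle eq_sym yf0 y0.
  have := le_degree2 y0 fe vf ve; rewrite yv yf /= => le1.
  by rewrite (_ : y f < 1); [|lra].
have := tight_not_row_free Gb F0 T2.
set A := \matrix_(i, j) _; rewrite -kermx_eq0 => kerA.
have /rowV0Pn[r /sub_kermxP rA r0] := kerA.
have [i ri] : exists i, r 0 i != 0.
  apply/existsP; apply: contraR r0; rewrite negb_exists => /forallP h.
  by apply/eqP/rowP => i; rewrite mxE; apply/eqP; have := h i; rewrite negbK.
pose d e := \sum_(i < #|F|) (enum_val i == e)%:R * r 0 i.
have dE i' : d (enum_val i') = r 0 i'.
  rewrite /d (bigD1 i')//= eqxx mul1r big1 ?addr0// => j ji.
  by rewrite (inj_eq enum_val_inj) (negbTE ji) mul0r.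
have dF e : d e != 0 -> e \in F.
  apply: contraR => eF; apply/eqP/big1 => j _.
  by case: eqP eF => [<-|_ _]; rewrite ?enum_valP ?mul0r.
exists d; split; [by exists (enum_val i); rewrite dE| exact: dF |].
move=> v yv.
have degE : degree d v = \sum_(j < #|F|) r 0 j * (v \in ends G (enum_val j))%:R.
  rewrite /degree -(eq_bigr _ (fun j _ => congr1 (fun z => z * _) (dE j))).
  rewrite -(big_enum_val (A := mem F) (fun e => d e * (v \in ends G e)%:R)).
  rewrite big_mkcond [RHS]big_mkcond; apply: eq_bigr => e _.
  case: ifP => ve; case: ifP => eF; rewrite ?mulr1 ?mulr0//.
  by apply/eqP; apply: contraFT eF => /dF.
have [vT|vT] := boolP (v \in T).
  have := congr1 (fun M : 'rV[R]_#|T| => M 0 (enum_rank_in vT v)) rA; rewrite !mxE => <-.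
  rewrite degE; apply: eq_bigr => j _; rewrite !mxE enum_rankK_in//.
(* A tight vertex outside [T] meets no fractional edge, so every term is 0. *)
rewrite degE big1// => j _; case: (boolP (v \in _)) => [ve|]; rewrite ?mulr0//.
case/negP: vT; rewrite inE yv eqxx; apply/existsP.
by exists (enum_val j); rewrite enum_valP.
Qed.

(** Slacks equal to 0 stay 0 along [d], so the ratio test stops at a newly vanishing slack without
    losing an old one. *)
Lemma fractional_move y d : (forall e, 0 <= y e) ->
    (forall v, degree y v <= 1) -> (exists e, d e != 0) ->
    (forall e, d e != 0 -> e \in fractional y) ->
    (forall v, degree y v = 1 -> degree d v = 0) ->
  exists2 t, 0 < t & let y' := fun e => y e + t * d e in
    [/\ forall e, 0 <= y' e, forall v, degree y' v <= 1
      & (#|[pred i | slack y' i != 0%R]| < #|[pred i | slack y i != 0%R]|)%N].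
Proof.
move=> y0 y1 [e de] dF dT.
pose c i : R := match i with inl e => d e | inr v => - degree d v end.
have sc i : slack y i = 0 -> c i = 0.
  case: i => [f|v] /= yi.
    by apply/eqP; apply: contra_eqT yi => /dF; rewrite inE => /andP[/lt0r_neq0].
  by rewrite dT ?oppr0//; apply/esym/eqP; rewrite -subr_eq0 yi.
have s0 i : 0 <= slack y i by case: i => //= v; rewrite subr_ge0.
(* If no entry of [d] is negative, [d] has positive degree at an end of [e], and the slack of that
   vertex decreases. *)
have cneg : exists i, c i < 0.
  have [/existsP[f df]|/existsPn dge0] := boolP [exists f, d f < 0].
    by exists (inl f).
  have d0 f : 0 <= d f by rewrite leNgt.
  have [v ve] := end_of e; exists (inr v); rewrite /= oppr_lt0.
  apply: lt_le_trans (le_degree d0 ve).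
  by rewrite lt_neqAle eq_sym de d0.
have [t t0 [ts [i si0 si]]] := ratio_test s0 sc cneg.
exists t => //=; split.
- by move=> f; have := ts (inl f).
- by move=> v; have := ts (inr v); rewrite degreeD /=; lra.
apply: proper_card; apply/fintype.properP; split.
  apply/fintype.subsetP => j; rewrite !inE; apply: contra => /eqP sj.
  by rewrite slack_shift -/(c j) sc// sj mulr0 addr0.
by exists i; rewrite !inE // slack_shift -/(c i) si eqxx.
Qed.

(** Induction on the number of nonzero slacks. Without fractional edges [y] is the indicator of a
    matching; otherwise it lies between the points reached along [d] and its opposite, and the two
    laws found there are mixed. *)
Lemma bipartite_matching_integral y : bipartite G -> (forall e, 0 <= y e) ->
    (forall v, degree y v <= 1) ->
  exists d : fdist R {set E},
    (forall S, d S != 0 -> S \in matchings G) /\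
    forall e, Prob d (fun S => e \in S) = y e.
Proof.
move=> Gb.
have [n] := ubnP #|[pred i | slack y i != 0]|; elim: n y => // n IHn y.
rewrite ltnS => yn y0 y1.
have [F0|F0] := eqVneq (fractional y) finset.set0.
  have y01 e : y e = 0 \/ y e = 1.
    have [v ve] := end_of e; have le1 := le_trans (le_degree y0 ve) (y1 v).
    have := finset.in_set0 e; rewrite -F0 inE => /negbT.
    rewrite negb_and -!leNgt => /orP[] le; [left|right]; apply/eqP; rewrite eq_le.
      by rewrite le y0.
    by rewrite le le1.
  exists (fdirac R [set e | y e == 1]%SET); split=> [S|e].
    rewrite /= pnatr_eq0 eqb0 negbK => /eqP->; rewrite inE.
    apply/forall_inP => e; rewrite inE => /eqP ye; apply/forall_inP => f.
    rewrite inE => /eqP yf; apply/implyP => ef; rewrite -finset.setI_eq0.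
    apply/eqP/finset.setP => v; rewrite !inE; apply/negP => /andP[ve vf].
    by have := le_trans (le_degree2 y0 ef ve vf) (y1 v); rewrite ye yf; lra.
  rewrite Prob_fdirac inE.
  by have [->|->] := y01 e; rewrite ?eqxx// eq_sym oner_eq0.
have [d [dn0 dF dT]] := fractional_direction Gb y0 y1 F0.
have [t1 t1_gt0 /=[y10 y11 lt1]] := fractional_move y0 y1 dn0 dF dT.
have [|e|v /dT|t2 t2_gt0 /=[y20 y21 lt2]] := @fractional_move y (fun e => - d e) y0 y1.
- by have [e de] := dn0; exists e; rewrite oppr_eq0.
- by rewrite oppr_eq0; apply: dF.
- by rewrite /degree sumrN => ->; rewrite oppr0.
have [d1 [d1M d1y]] := IHn _ (leq_trans lt1 yn) y10 y11.
have [d2 [d2M d2y]] := IHn _ (leq_trans lt2 yn) y20 y21.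
have t12 : 0 < t1 + t2 by rewrite addr_gt0.
(* With this weight on the first point the displacements t1 d and - t2 d cancel. *)
have p01 : 0 <= t2 / (t1 + t2) <= 1.
  by rewrite divr_ge0 ?(ltW t2_gt0) ?(ltW t12)//= ler_pdivrMr// mul1r lerDr ltW.
exists (fmix p01 d1 d2); split=> [S|e].
  have [d1S|/d1M//] := eqVneq (d1 S) 0; have [d2S|/d2M//] := eqVneq (d2 S) 0.
  by rewrite /= d1S d2S !mulr0 addr0 eqxx.
rewrite Prob_fmix d1y d2y; field; exact: lt0r_neq0.
Qed.

End BipartiteIntegrality.

(** * Truncation bound for the constant beta *)

Section BetaBound.
Variable R : realType.

Lemma poisson_prob1 (b : R) (n : nat) : 0 <= b ->
  poisson_prob b 0%N [set n]%classic = (pois b n)%:E.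
Proof.
rewrite le_eqVlt /poisson_prob => /orP[/eqP<-|b0].
  by rewrite ltxx pois0 diracE; case: n => [|n]; [rewrite mem_set|rewrite memNset].
rewrite b0 esum_set1 ?lee_fin ?poisson_pmf_ge0//.
by rewrite /poisson_pmf b0 unlock mulrC.
Qed.

Lemma measurable_nat2 (A : set (nat * nat)) : measurable A.
Proof.
apply: countable_measurable; last exact: countableP.
move=> [n m]; rewrite (_ : [set _]%classic = ([set n] `*` [set m])%classic).
  exact: measurableX.
by apply/seteqP; split=> [_ ->//|[i j] [/= -> ->]].
Qed.

(** The function 1 - g dominates its restriction to the box [0, M)^2, whose integral is a finite sum
    of point masses; the expectation of g is never expanded as a series. *)
Lemma beta_le (b : R) (M : nat) : 0 <= b ->
  beta b <= pois2 M b b (fun n m => (1 + maxn n m)%:R^-1) + (1 - pois_mass M b ^+ 2).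
Proof.
move=> b0; set g := fun n m : nat => (1 + maxn n m)%:R^-1 : R.
have g01 n m : 0 <= g n m <= 1.
  by rewrite invr_ge0 ler0n /= invf_le1 ?ltr0n// ler1n.
rewrite /beta; set P := product_prob _ _.
have mf (h : nat * nat -> R) : measurable_fun setT (EFin \o h).
  by move=> _ Y _; apply: measurable_nat2.
pose f (X : nat * nat) : R := g X.1 X.2.
pose c (p : 'I_M * 'I_M) (X : nat * nat) : R :=
  (1 - g p.1 p.2) * \1_[set (p.1 : nat, p.2 : nat)]%classic X.
have c0 p X : 0 <= c p X.
  by rewrite mulr_ge0// subr_ge0; case/andP: (g01 p.1 p.2).
have cE X : \sum_p c p X <= 1 - f X.
  have fX : 0 <= 1 - f X by rewrite subr_ge0; case/andP: (g01 X.1 X.2).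
  have [/existsP[p0 /eqP pX]|/existsPn no] :=
      boolP [exists p : 'I_M * 'I_M, (p.1 : nat, p.2 : nat) == X].
    rewrite (bigD1 p0)//= big1 ?addr0 => [|p pp0].
      by rewrite /c /f -pX indicE mem_set// mulr1.
    rewrite /c indicE memNset ?mulr0// => /= XE; move/eqP: pp0; apply.
    move: pX; rewrite XE => -[e1 e2].
    by rewrite [p]surjective_pairing [p0]surjective_pairing; congr pair; apply: val_inj.
  rewrite big1// => p _; rewrite /c indicE memNset ?mulr0// => /= XE.
  by have /eqP := no p; rewrite -XE.
have Ef0 : (0 <= 'E_P [f])%E.
  rewrite unlock; apply: integral_ge0 => X _.
  by rewrite lee_fin; case/andP: (g01 X.1 X.2).
have P1 (p : 'I_M * 'I_M) : P [set (p.1 : nat, p.2 : nat)]%classic =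
    (pois b p.1 * pois b p.2)%:E.
  rewrite (_ : [set _]%classic = ([set (p.1 : nat)] `*` [set (p.2 : nat)])%classic).
    transitivity (poisson_prob b 0%N [set (p.1 : nat)]%classic *
        poisson_prob b 0%N [set (p.2 : nat)]%classic)%E.
      exact: product_measure1E.
    by rewrite !poisson_prob1.
  by apply/seteqP; split=> [_ ->//|[i j] [/= -> ->]].
have Ec p : (\int[P]_X (c p X)%:E = ((1 - g p.1 p.2) * (pois b p.1 * pois b p.2))%:E)%E.
  rewrite /c; under eq_integral do rewrite EFinM.
  rewrite ge0_integralZl_EFin//.
  - rewrite integral_indic; [|exact: measurableT|exact: measurable_nat2].
    by rewrite setIT [RHS]EFinM -P1.
  - exact: (mf (fun X => \1_[set (p.1 : nat, p.2 : nat)]%classic X)).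
  - by rewrite subr_ge0; case/andP: (g01 p.1 p.2).
have : ('E_P [f] +
    \sum_(p : 'I_M * 'I_M) ((1 - g p.1 p.2) * (pois b p.1 * pois b p.2))%:E <= 1)%E.
  under eq_bigr do rewrite -Ec.
  rewrite unlock -ge0_integral_sum//; last 2 first.
  - by move=> p; apply: mf.
  - by move=> p X _; rewrite lee_fin.
  rewrite -ge0_integralD//; last 4 first.
  - by move=> X _; rewrite lee_fin; case/andP: (g01 X.1 X.2).
  - exact: (mf f).
  - by move=> X _; apply: sume_ge0 => p _; rewrite lee_fin.
  - by move=> _ Y _; apply: measurable_nat2.
  rewrite -(probability_setT P) -[leRHS]mul1e -integral_cst//.
  apply: ge0_le_integral => //.
  - move=> X _; apply: adde_ge0; last by apply: sume_ge0 => p _; rewrite lee_fin.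
    by rewrite lee_fin; case/andP: (g01 X.1 X.2).
  - by move=> _ Y _; apply: measurable_nat2.
  move=> X _; rewrite sumEFin -EFinD lee_fin; have := cE X; lra.
rewrite -/f sumEFin.
(* The infinite values, which [fine] sends to 0, contradict the bound by 1 or nonnegativity. *)
case: ('E_P [f])%E Ef0 => [r|//|//] _ /=.
rewrite -EFinD lee_fin => le1.
suff : \sum_(p : 'I_M * 'I_M) (1 - g p.1 p.2) * (pois b p.1 * pois b p.2) =
    pois_mass M b ^+ 2 - pois2 M b b g by move=> sE; move: le1; rewrite sE; lra.
rewrite -(pair_bigA _ (fun i j : 'I_M => (1 - g i j) * (pois b i * pois b j)))/=.
rewrite expr2 {1}/pois_mass mulr_suml -sumrB; apply: eq_bigr => i _.
rewrite mulr_sumr -sumrB; apply: eq_bigr => j _; ring.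
Qed.

End BetaBound.

(** * Degree bounds on the matching polytope *)

Section MatchingPolytope.
Variables (R : realType) (V E : finType) (G : multigraph V E).

Lemma matching_polytope_degree (x : vec R E) : matching_polytope R G x ->
  (forall e, 0 <= x e) /\ forall v, degree G x v <= 1.
Proof.
pose C : set (vec R E) :=
  [set y | (forall e, 0 <= y e) /\ forall v, degree G y v <= 1]%classic.
suff sub : (matching_polytope R G `<=` C)%classic by move=> /sub.
apply: smallest_sub => [y z l|y [M /= + <-]].
  rewrite !inE => -[y0 y1] [z0 z1].
  have l0 : 0 <= l%:num by []; have l1 : l%:num <= 1 by [].
  have cE e : (conv l y z : vec R E) e = l%:num * y e + (1 - l%:num) * z e.
    by rewrite /conv /= !ffunE.
  split=> [e|v]; first by rewrite cE addr_ge0 ?mulr_ge0 ?subr_ge0.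
  rewrite /degree; under eq_bigr do rewrite cE.
  rewrite big_split /= -!mulr_sumr.
  have := y1 v; have := z1 v; rewrite /degree; nra.
rewrite inE => /forall_inP Mm; split=> [e|v]; first by rewrite ffunE.
rewrite /degree; have [/existsP[e /andP[eM ve]]|/existsPn no] :=
    boolP [exists e, (e \in M) && (v \in ends G e)].
  rewrite (bigD1 e)//= big1 ?addr0 => [|f /andP[vf fe]]; first by rewrite ffunE eM.
  rewrite ffunE; case: (boolP (f \in M)) => // fM.
  have /forall_inP/(_ f fM)/implyP := Mm e eM; rewrite eq_sym => /(_ fe).
  by rewrite disjoint_sym => /disjointFr /(_ vf); rewrite ve.
rewrite big1// => e ve; rewrite ffunE; have := no e; rewrite ve andbT.
by move=> /negbTE->.
Qed.

Lemma dilate_matching_polytope b (x : vec R E) : 0 <= b ->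
    dilate b (matching_polytope R G) x ->
  (forall e, 0 <= x e) /\ forall v, degree G x v <= b.
Proof.
move=> b0 [y /matching_polytope_degree[y0 y1] <-]; split=> [e|v].
  by rewrite ffunE mulr_ge0.
rewrite /degree; under eq_bigr do rewrite ffunE.
rewrite -mulr_sumr; exact: ler_piMr b0 (y1 v).
Qed.

End MatchingPolytope.

(** * From random presence to Poisson multiplicity *)

Section Thinning.
Variable R : realType.
Implicit Types (x : R) (k N : nat).

(* Keep an element that is present with probability x with probability
   (1 - exp(-x)) / x, then draw a Poisson(x) variable conditioned on being
   positive: the resulting multiplicity is exactly Poisson(x). *)
Definition thin x k : R :=
  if k is 0 then (x - 1 + expR (- x)) / x else pois x k / x.

Lemma thin_mix x k : x * thin x k + (1 - x) * (k == 0%N)%:R = pois x k.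
Proof.
have [->|x0] := eqVneq x 0; first by rewrite mul0r add0r subr0 mul1r pois0.
case: k => [|k] /=; last by rewrite mulr0 addr0 mulrCA divff ?mulr1.
by rewrite unlock expr0 fact0 divr1 mulr1; field.
Qed.

Lemma thin_ge0 x k : 0 <= x -> 0 <= thin x k.
Proof.
move=> x0; case: k => [|k] /=; rewrite divr_ge0 ?pois_ge0//.
by have := expR_ge1Dx (- x); lra.
Qed.

Lemma thin_sum_le1 x N : 0 <= x -> \sum_(k < N.+1) thin x k <= 1.
Proof.
rewrite le_eqVlt => /orP[/eqP<-|x0].
  (* At x = 0 both branches of [thin] divide by 0 and hence are 0. *)
  by rewrite big1// => -[[|k] ?] _ /=; rewrite invr0 mulr0.
rewrite -(ler_pM2l x0) mulr1 mulr_sumr.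
have -> : \sum_(k < N.+1) x * thin x k = pois_mass N.+1 x - (1 - x).
  rewrite /pois_mass; under [X in _ = X - _]eq_bigr do rewrite -thin_mix.
  by rewrite big_split /= -[X in _ + X - _]mulr_sumr sum_ord_eq0 mulr1 addrK.
by have := pois_mass_le1 N.+1 (ltW x0); lra.
Qed.

End Thinning.

(** * Marginals given by expected shares *)

Section Marginals.
Variables (R : realType) (V E : finType) (G : multigraph V E).
Implicit Types (e f : E) (v : V) (N k : nat) (A B : {set E}) (x : E -> R).

Definition load (q : E -> nat) v : nat := \sum_(f | v \in ends G f) q f.

Definition share e (q : E -> nat) : R :=
  (q e)%:R / (\max_(v in ends G e) load q v)%:R.

Lemma load_le_max e (q : E -> nat) v : v \in ends G e ->
  (load q v <= \max_(w in ends G e) load q w)%N.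
Proof. by move=> ve; apply: leq_bigmax_cond. Qed.

Lemma share_ge0 e q : 0 <= share e q.
Proof. by rewrite divr_ge0. Qed.

(** Replacing each maximum by the load at the common end [v] only raises the shares, which then sum
    to 1 if that load is positive. *)
Lemma sum_share_le1 q v : \sum_(e | v \in ends G e) share e q <= 1.
Proof.
have [D0|D0] := posnP (load q v).
  rewrite big1// => e ve; rewrite /share; move/eqP: D0.
  by rewrite sum_nat_eq0 => /forall_inP/(_ e ve)/eqP->; rewrite mul0r.
have D0' : 0 < (load q v)%:R :> R by rewrite ltr0n.
apply: (@le_trans _ _ (\sum_(e | v \in ends G e) (q e)%:R / (load q v)%:R)).
  apply: ler_sum => e ve; apply: ler_wpM2l => //.
  have le := load_le_max q ve.
  by rewrite lef_pV2 ?posrE ?ler_nat// ltr0n (leq_trans D0).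
by rewrite -mulr_suml -natr_sum divff// gt_eqF.
Qed.

Lemma share_anti e f q k : f != e -> share e (upd q f k) <= share e (upd q f 0).
Proof.
move=> fe; rewrite /share /upd eq_sym (negbTE fe).
have [->|qe] := posnP (q e); first by rewrite !mul0r.
have [v ve] := end_of G e.
apply: ler_wpM2l => //; rewrite lef_pV2 ?posrE ?ltr0n ?ler_nat.
- apply/bigmax_leqP => w we; apply: leq_trans (load_le_max _ we).
  by apply: leq_sum => g _; case: eqP.
- apply: leq_trans (load_le_max _ ve).
  by rewrite /load (bigD1 e)//= eq_sym (negbTE fe) ltn_addr.
- apply: leq_trans (load_le_max _ ve).
  by rewrite /load (bigD1 e)//= eq_sym (negbTE fe) ltn_addr.
Qed.

Definition wt x A f k : R := if f \in A then thin (x f) k else (k == 0%N)%:R.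

Definition marg_trunc N x A e : R := prodsum N (wt x A) (share e).

(** For nonnegative [x] the truncations are nondecreasing and at most 1, so this limit exists; it is
    the vector y of the construction conditioned on R(x) = A. *)
Definition marg x A e : R := limn (fun N => marg_trunc N x A e).

Section NonnegativeWeights.
Variables (x : E -> R) (x_ge0 : forall f, 0 <= x f).

Lemma wt_ge0 A f k : 0 <= wt x A f k.
Proof. by rewrite /wt; case: ifP => // _; apply: thin_ge0. Qed.

Lemma wt_sum_le1 A f N : \sum_(k < N.+1) wt x A f k <= 1.
Proof.
rewrite /wt; case: (f \in A); first exact: thin_sum_le1.
by rewrite sum_ord_eq0.
Qed.

Lemma marg_trunc_ge0 N A e : 0 <= marg_trunc N x A e.
Proof. by apply: prodsum_ge0 => [f k|q]; [apply: wt_ge0|apply: share_ge0]. Qed.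

Lemma marg_trunc_degree N A v : degree G (marg_trunc N x A) v <= 1.
Proof.
rewrite /degree (prodsum_sum N (wt x A) _ _ share).
apply: (@le_trans _ _ (prodsum N (wt x A) (fun=> 1))).
  by apply: le_prodsum => [f k|q]; [apply: wt_ge0|apply: sum_share_le1].
rewrite prodsum_cst mulr1; apply: prodr_ile1 => f _.
by rewrite wt_sum_le1 andbT; apply: sumr_ge0 => k _; apply: wt_ge0.
Qed.

Lemma marg_trunc_nondecreasing A e : nondecreasing_seq (fun N => marg_trunc N x A e).
Proof.
by move=> M N MN; apply: le_prodsum_trunc => // *; [apply: wt_ge0|apply: share_ge0].
Qed.

Lemma marg_trunc_is_cvg A e : cvgn (fun N => marg_trunc N x A e).
Proof.
apply: nondecreasing_is_cvgn; first exact: marg_trunc_nondecreasing.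
exists 1 => _ [N _ <-]; have [v ve] := end_of G e.
exact: le_trans (le_degree (marg_trunc_ge0 N A) ve) (marg_trunc_degree N A v).
Qed.

Lemma marg_trunc_le N A e : marg_trunc N x A e <= marg x A e.
Proof.
apply: nondecreasing_cvgn_le; last exact: marg_trunc_is_cvg.
exact: marg_trunc_nondecreasing.
Qed.

Lemma marg_ge0 A e : 0 <= marg x A e.
Proof. exact: le_trans (marg_trunc_ge0 0 A e) (marg_trunc_le _ _ _). Qed.

Lemma marg_degree A v : degree G (marg x A) v <= 1.
Proof.
have cv : (degree G (marg_trunc N x A) v @[N --> \oo] --> degree G (marg x A) v)%classic.
  apply: cvg_big => [|e _]; [exact: add_continuous|exact: marg_trunc_is_cvg].
rewrite -(cvg_lim _ cv)//; apply: limr_le; first by apply/cvg_ex; eexists; exact: cv.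
by apply: nearW => N; apply: marg_trunc_degree.
Qed.

Lemma marg_notin A e : e \notin A -> marg x A e = 0.
Proof.
move=> eA; rewrite /marg (_ : (fun N => _) = fun=> 0); first exact: lim_cst.
apply/funext => N; apply: big1 => q _; rewrite /share.
have [->|qe] := posnP (q e); first by rewrite mul0r mulr0.
by rewrite (bigD1 e)//= /wt (negbTE eA) gtn_eqF// !mul0r.
Qed.

(** Induction on the size of B \ A: by [prodsum_drop] and [share_anti], forcing the multiplicity of
    one more edge to 0 cannot lower the expected share of [e]. *)
Lemma marg_trunc_anti N A B e : e \in A -> A \subset B ->
  marg_trunc N x B e <= marg_trunc N x A e.
Proof.
have [n] := ubnP #|B :\: A|; elim: n A => // n IHn A; rewrite ltnS => leAB eA AB.
have [BA0|[f fBA]] := set_0Vmem (B :\: A).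
  have /eqP-> : A == B by rewrite finset.eqEsubset AB -finset.setD_eq0 BA0 eqxx.
  by [].
move: (fBA); rewrite inE => /andP[fA fB].
apply: (@le_trans _ _ (marg_trunc N x (f |: A) e)).
  apply: IHn; rewrite ?inE ?eA ?orbT//.
    apply: leq_trans leAB; apply: proper_card; apply/fintype.properP; split.
      by apply: finset.setDS; apply: finset.subsetUr.
    by exists f => //; rewrite !inE eqxx.
  by rewrite finset.subUset finset.sub1set fB.
apply: (@prodsum_drop _ _ _ _ _ f).
- by move=> k; rewrite /wt (negbTE fA).
- by move=> g gf k; rewrite /wt !inE (negbTE gf).
- by move=> g k; apply: wt_ge0.
- exact: wt_sum_le1.
- exact: share_ge0.
- by move=> q k; apply: share_anti; apply: contraNneq fA => ->.
Qed.

Lemma marg_anti A B e : e \in A -> A \subset B -> marg x B e <= marg x A e.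
Proof.
move=> eA AB; apply: ler_lim; [exact: marg_trunc_is_cvg|exact: marg_trunc_is_cvg|].
by apply: nearW => N; apply: marg_trunc_anti.
Qed.

End NonnegativeWeights.

Lemma Rx_pmfE (x : vec R E) A : Rx_pmf x A = \prod_f (if f \in A then x f else 1 - x f).
Proof.
rewrite /Rx_pmf [in RHS](bigID (fun f => f \in A)) /=; congr (_ * _).
  by apply: eq_bigr => f ->.
apply: eq_big => [f|f]; first by rewrite inE.
by rewrite inE => /negbTE->.
Qed.

(** By distributivity the sum over [A] becomes a product over edges, and [thin_mix] identifies each
    factor as a Poisson weight. *)
Lemma sum_Rx_marg_trunc N (x : vec R E) e :
  \sum_A Rx_pmf x A * marg_trunc N x A e =
  prodsum N (fun f => pois (x f)) (share e).
Proof.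
rewrite /marg_trunc /prodsum; under eq_bigr do rewrite mulr_sumr.
rewrite exchange_big; apply: eq_bigr => q _ /=.
under eq_bigr do rewrite mulrA.
rewrite -mulr_suml; congr (_ * _).
under [RHS]eq_bigr do rewrite -thin_mix.
rewrite bigA_distr; apply: eq_bigr => A _; rewrite Rx_pmfE -big_split /=.
by apply: eq_bigr => f _; rewrite /wt; case: ifP.
Qed.

Lemma prodsum_pois_share_ge N M b x e : (M <= N)%N -> (forall f, 0 <= x f) ->
    (forall v, degree G x v <= b) ->
  x e * ((\prod_f pois_mass M (x f)) *
    pois2 M b b (fun n m => (1 + maxn n m)%:R^-1)) <=
  prodsum N (fun f => pois (x f)) (share e).
Proof.
move=> MN x0 xb.
have /eqP/cards2P[u [w [uw euw]]] := card_ends2 G e.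
have degE v : \sum_f (v \in ends G f)%:R * x f = degree G x v.
  rewrite /degree [RHS]big_mkcond; apply: eq_bigr => f _.
  by case: ifP => _; rewrite ?mul1r ?mul0r.
have loadE q v : load q v = (\sum_f (v \in ends G f) * q f)%N.
  rewrite /load big_mkcond; apply: eq_bigr => f _.
  by case: ifP => _; rewrite ?mul1n ?mul0n.
have -> : share e = fun q => (q e)%:R /
    (maxn (\sum_f (u \in ends G f) * q f) (\sum_f (w \in ends G f) * q f))%:R.
  apply/funext => q; rewrite /share euw finset.big_setU1 ?inE//= finset.big_set1.
  by rewrite !loadE.
by apply: prodsum_pois_share; rewrite ?degE// euw !inE eqxx ?orbT.
Qed.

End Marginals.

(** * Balancedness and assembly of the scheme *)

Section Scheme.
Variables (R : realType) (V E : finType) (G : multigraph V E).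

Lemma cvg_prod_pois_mass (x : E -> R) :
  (\prod_f pois_mass M (x f) @[M --> \oo] --> (1 : R))%classic.
Proof.
rewrite -[X in (_ --> X)%classic](big1_eq (op := *%R) (index_enum E) xpredT).
apply: cvg_big => [|f _]; [exact: mul_continuous|exact: cvg_pois_mass].
Qed.

Lemma beta_selection b (x : vec R E) e : 0 <= b <= 1 -> (forall f, 0 <= x f) ->
    (forall v, degree G x v <= b) ->
  beta b * x e <= \sum_A Rx_pmf x A * marg G x A e.
Proof.
move=> /andP[b0 b1] x0 xb; set sel := \sum_A _.
have x1 f : x f <= 1.
  by have [v vf] := end_of G f; apply: le_trans (le_degree x0 vf) (le_trans (xb v) b1).
have Rx0 A : 0 <= Rx_pmf x A.
  by rewrite Rx_pmfE; apply: prodr_ge0 => f _; case: ifP; rewrite ?subr_ge0.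
(* [u M] is the bound at truncation level [M], with [beta_le] applied to [pois2]; all masses tend to
   1, so it tends to [beta b * x e]. *)
pose u M := x e * ((\prod_f pois_mass M (x f)) * (beta b - (1 - pois_mass M b ^+ 2))).
have cu : (u M @[M --> \oo] --> x e * (1 * (beta b - (1 - 1 ^+ 2))))%classic.
  apply: cvgMr; apply: cvgM; first exact: cvg_prod_pois_mass.
  apply: cvgB; first exact: cvg_cst.
  apply: cvgB; first exact: cvg_cst.
  by rewrite expr2; under eq_fun do rewrite expr2; apply: cvgM; exact: cvg_pois_mass.
have -> : beta b * x e = x e * (1 * (beta b - (1 - 1 ^+ 2))) by ring.
rewrite -(cvg_lim _ cu)//; apply: limr_le; first by apply/cvg_ex; eexists; exact: cu.
apply: nearW => M.
apply: (@le_trans _ _ (\sum_A Rx_pmf x A * marg_trunc G M x A e)); last first.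
  by apply: ler_sum => A _; rewrite ler_wpM2l ?marg_trunc_le.
rewrite sum_Rx_marg_trunc; apply: le_trans (prodsum_pois_share_ge e (leqnn M) x0 xb).
rewrite ler_wpM2l// ler_wpM2l//; first by apply: prodr_ge0 => f _; apply: pois_mass_ge0.
by have := beta_le M b0; lra.
Qed.

End Scheme.

Theorem theorem5 (R : realType) (b : R) (b01 : 0 <= b <= 1)
    (V E : finType) (G : multigraph V E) (G_bip : bipartite G) :
  exists pi : scheme R E,
    balanced_CR_scheme (matchings G) (matching_polytope R G) b (beta b) pi /\
    monotone_scheme (matching_polytope R G) b pi.
Proof.
have b0 : 0 <= b by case/andP: b01.
have [pi piP] : exists pi : scheme R E, forall x A, dilate b (matching_polytope R G) x ->
    (forall S, pi x A S != 0 -> S \in matchings G) /\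
    forall e, Prob (pi x A) (fun S => e \in S) = marg G x A e.
  have ex (x : vec R E) (A : {set E}) : {d : fdist R {set E} |
      dilate b (matching_polytope R G) x -> (forall S, d S != 0 -> S \in matchings G) /\
      forall e, Prob d (fun S => e \in S) = marg G x A e}.
    apply: cid; have [xP|xNP] := pselect (dilate b (matching_polytope R G) x).
      have [x0 _] := dilate_matching_polytope b0 xP.
      have [d dP] := bipartite_matching_integral G_bip
        (marg_ge0 G x0 A) (marg_degree G x0 A).
      by exists d.
    (* A dummy law for [x] outside bP. *)
    by exists (fdirac R finset.set0).
  by exists (fun x A => sval (ex x A)) => x A; exact: (svalP (ex x A)).
exists pi; split; [split|] => [x A S xP Asub piS|x e xP _|x e A B xP eA AB _].
- have [piM pim] := piP x A xP; split; last exact: piM.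
  (* An edge outside [A] has marginal 0, so no set containing it has positive probability. *)
  apply/fintype.subsetP => e eS; apply: contraNT piS => eA.
  apply/eqP; apply: (@Prob_eq0 _ _ _ (fun T : {set E} => e \in T)) => //.
  by rewrite pim marg_notin.
- have [x0 xb] := dilate_matching_polytope b0 xP.
  rewrite /selection_prob; under eq_bigr => A _ do rewrite (piP x A xP).2.
  exact: beta_selection.
- have [x0 _] := dilate_matching_polytope b0 xP.
  by rewrite (piP x A xP).2 (piP x B xP).2; apply: marg_anti.
Qed.
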